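(* Let $d,s,\nu$ be positive integers, let $\boldsymbol n\in\mathbb N^d$, and let $\{\Omega_1,\ldots,\Omega_\nu\}$ be a partition of $[0,1]^d$. Then, for every $A\in\mathbb C^{N(\boldsymbol n)s\times N(\boldsymbol n)s}$ such that $R_{\Omega_1,\Omega_1}^{\boldsymbol n,s,s}(A),\ldots,R_{\Omega_\nu,\Omega_\nu}^{\boldsymbol n,s,s}(A)$ are invertible, the matrix $\mathcal D:=\mathrm{blockdiag}^{\boldsymbol n,s,s}_{\Omega_1,\ldots,\Omega_\nu}(A)$ is invertible, $$\mathcal D^{-1}=\sum_{i=1}^{\nu}\mathrm{RIE}_{\Omega_i}^{\boldsymbol n,s}(A),$$ and, for $i=1,\ldots,\nu$, $$\mathrm{RIE}_{\Omega_i}^{\boldsymbol n,s}(A)=D_{\boldsymbol n}(\chi_{\Omega_i}I_s)\,\mathcal D^{-1}=\mathcal D^{-1}D_{\boldsymbol n}(\chi_{\Omega_i}I_s)=D_{\boldsymbol n}(\chi_{\Omega_i}I_s)\,\mathcal D^{-1}D_{\boldsymbol n}(\chi_{\Omega_i}I_s)=Z_{\Omega_i,\Omega_i}^{\boldsymbol n,s,s}(\mathcal D^{-1}).$$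
   Context: **Multi-indices.** $\mathbb N=\{1,2,3,\ldots\}$, $\mathbf 1=(1,\ldots,1)$. For $\boldsymbol n\in\mathbb N^d$, $N(\boldsymbol n)=n_1n_2\cdots n_d$. The range $\{\mathbf 1,\ldots,\boldsymbol n\}$ is $\{\boldsymbol i\in\mathbb Z^d:1\le i_k\le n_k\ \forall k\}$, ordered lexicographically. Vector operations are componentwise, e.g. $\boldsymbol i/\boldsymbol n=(i_1/n_1,\ldots,i_d/n_d)$. A matrix $A$ of size $N(\boldsymbol n)s\times N(\boldsymbol n)s$ is viewed as a block matrix $A=[A_{\boldsymbol i\boldsymbol j}]_{\boldsymbol i,\boldsymbol j=\mathbf 1}^{\boldsymbol n}$ with $s\times s$ blocks. For $\Omega\subseteq\mathbb R^d$, $\mathcal I_{\boldsymbol n}^\Omega=\{\boldsymbol i\in\{\mathbf 1,\ldots,\boldsymbol n\}:\boldsymbol i/\boldsymbol n\in\Omega\}$ and $N_{\boldsymbol n}^\Omega=|\mathcal I_{\boldsymbol n}^\Omega|$. $\chi_\Omega$ is the characteristic function of $\Omega$, $I_s$ the $s\times s$ identity. A partition of $[0,1]^d$ is a family of pairwise disjoint sets whose union is $[0,1]^d$. **Operators.** For $a:[0,1]^d\to\mathbb C^{s\times s}$, $D_{\boldsymbol n}(a)$ is the $N(\boldsymbol n)s\times N(\boldsymbol n)s$ block diagonal matrix with $(\boldsymbol i,\boldsymbol i)$ block $a(\boldsymbol i/\boldsymbol n)$. For $\Omega_L,\Omega_R\subseteq[0,1]^d$ and $A\in\mathbb C^{N(\boldsymbol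 n)s\times N(\boldsymbol n)s}$, the zeroing operator is $Z_{\Omega_L,\Omega_R}^{\boldsymbol n,s,s}(A)=D_{\boldsymbol n}(\chi_{\Omega_L}I_s)\,A\,D_{\boldsymbol n}(\chi_{\Omega_R}I_s)$, and $\mathrm{blockdiag}_{\Omega_1,\ldots,\Omega_\nu}^{\boldsymbol n,s,s}(A)=\sum_{i=1}^\nu Z_{\Omega_i,\Omega_i}^{\boldsymbol n,s,s}(A)$. For $\Omega\subseteq[0,1]^d$, the restriction matrix $R_\Omega^{\boldsymbol n,s}$ is the $N_{\boldsymbol n}^\Omega s\times N(\boldsymbol n)s$ matrix obtained from $D_{\boldsymbol n}(\chi_\Omega I_s)$ by removing the block rows with multi-index $\boldsymbol i\notin\mathcal I_{\boldsymbol n}^\Omega$. Let $R_{\Omega,\Omega}^{\boldsymbol n,s,s}(A)=R_\Omega^{\boldsymbol n,s}A(R_\Omega^{\boldsymbol n,s})^T$ (the submatrix of $A$ with block row and column indices in $\mathcal I_{\boldsymbol n}^\Omega$), and for $B\in\mathbb C^{N_{\boldsymbol n}^\Omega s\times N_{\boldsymbol n}^\Omega s}$ let $E_{\Omega,\Omega}^{\boldsymbol n,s,s}(B)=(R_\Omega^{\boldsymbol n,s})^TBR_\Omega^{\boldsymbol n,s}$ (extension by zeros). When $R_{\Omega,\Omega}^{\boldsymbol n,s,s}(A)$ is invertible, the restriction-inversion-expansion operator is $\mathrm{RIE}_\Omega^{\boldsymbol n,s}(A)=E_{\Omega,\Omega}^{\boldsymbol n,s,s}\bigl(R_{\Omega,\Omega}^{\boldsymbol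 n,s,s}(A)^{-1}\bigr)$. *)

(* Defs.v *)
From HB Require Import structures.
From mathcomp Require Import all_boot all_order all_algebra complex.
From mathcomp Require Import boolp classical_sets reals numfun.

Set Implicit Arguments.
Unset Strict Implicit.
Unset Printing Implicit Defensive.

Import Order.TTheory GRing.Theory Num.Theory.
Local Open Scope classical_set_scope.
Local Open Scope ring_scope.
Local Open Scope complex_scope.

Definition Nprod (d : nat) (n : 'I_d -> nat) : nat := (\prod_(k < d) n k)%N.

(* The multi-indices 1, ..., n are listed in lexicographic order, the last
   component varying fastest: [midx n p] is the one at position p (counted from
   0), whose components are the mixed-radix digits of p, shifted by 1.
   [midx_bounds], [midx_lex] and [midx_onto] below check this reading. *)
Definition midx (d : nat) (n : 'I_d -> nat) (p : nat) (k : 'I_d) : nat :=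
  ((p %/ \prod_(j < d | (k < j)%N) n j) %% n k).+1.

Definition gridpt (R : realType) (d : nat) (n : 'I_d -> nat) (p : nat)
  : 'rV[R]_d := \row_(k < d) ((midx n p k)%:R / (n k)%:R).

Definition unit_cube (R : realType) (d : nat) : set 'rV[R]_d :=
  [set x | forall k : 'I_d, 0 <= x ord0 k <= 1].

(* Members of the family may be empty. *)
Definition cube_partition (R : realType) (d nu : nat)
    (Omega : 'I_nu -> set 'rV[R]_d) : Prop :=
  trivIset setT Omega /\ \bigcup_i Omega i = @unit_cube R d.

(* Matrices with m block rows (columns) of size s have \sum_(p < m) s = m * s
   rows (columns): the shape for which matrix.v provides block operations. *)
Notation bdim m s := (\sum_(_ < m) s)%N (only parsing).

Section Operators.
Variables (R : realType) (d s : nat) (n : 'I_d -> nat).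
Local Notation N := (Nprod n).
Local Notation bmx := 'M[R[i]]_(bdim N s).
Implicit Types Omega : set 'rV[R]_d.

(* Blocks are indexed by the positions of the multi-indices. *)
Definition Iset Omega : {set 'I_N} := [set p : 'I_N | gridpt R n p \in Omega].

Definition Ncard Omega : nat := #|Iset Omega|.

Definition Dmx (a : 'rV[R]_d -> 'M[R[i]]_s) : bmx :=
  \mxdiag_(p < N) a (gridpt R n p).

Definition chiI Omega (x : 'rV[R]_d) : 'M[R[i]]_s := (\1_Omega x)%:M.

Definition Zop OmegaL OmegaR (A : bmx) : bmx :=
  Dmx (chiI OmegaL) *m A *m Dmx (chiI OmegaR).

Definition blockdiag (nu : nat) (Omega : 'I_nu -> set 'rV[R]_d) (A : bmx)
  : bmx := \sum_(i < nu) Zop (Omega i) (Omega i) A.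

(* The r-th block row kept is the one at the r-th position of [Iset Omega];
   [enum_val] lists positions increasingly. *)
Definition Rmx Omega : 'M[R[i]]_(bdim (Ncard Omega) s, bdim N s) :=
  \mxcol_(r < Ncard Omega)
    submxcol (Dmx (chiI Omega)) (enum_val (r : 'I_#|Iset Omega|)).

Definition restr Omega (A : bmx) : 'M[R[i]]_(bdim (Ncard Omega) s) :=
  Rmx Omega *m A *m (Rmx Omega)^T.

Definition expand Omega (B : 'M[R[i]]_(bdim (Ncard Omega) s))
  : bmx := (Rmx Omega)^T *m B *m Rmx Omega.

(* Meaningful only when [restr Omega A \in unitmx]. *)
Definition RIE Omega (A : bmx) : bmx := expand (invmx (restr Omega A)).

End Operators.

Section MidxTheory.
Local Open Scope nat_scope.
Variables (d : nat) (n : 'I_d -> nat).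
Hypothesis n_gt0 : forall k, 0 < n k.

Lemma midx_bounds p k : 1 <= midx n p k <= n k.
Proof. by rewrite /midx /= ltn_mod. Qed.

Let T m := \prod_(j < d | m <= j) n j.

Let T_gt0 m : 0 < T m.
Proof. by apply: prodn_cond_gt0 => i _; apply: n_gt0. Qed.

Let T_rec (k : 'I_d) : T k = n k * T k.+1.
Proof.
rewrite /T (bigD1 k) //=; congr (_ * _); apply: eq_bigl => j.
by rewrite andbC ltn_neqAle eq_sym.
Qed.

Let digit_rec p (k : 'I_d) :
  p %/ T k.+1 = p %/ T k * n k + (midx n p k).-1.
Proof.
rewrite /midx /= -/(T k.+1) {1}(divn_eq (p %/ T k.+1) (n k)).
by rewrite T_rec [n k * _]mulnC divnMA.
Qed.

Let agree p q m : m <= d -> p < Nprod n -> q < Nprod n ->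
  (forall k : 'I_d, k < m -> midx n p k = midx n q k) -> p %/ T m = q %/ T m.
Proof.
move=> + pN qN; elim: m => [|m IH] md H.
  by rewrite /T; under eq_bigl do rewrite leq0n; rewrite !divn_small.
rewrite -[m]/(val (Ordinal md)) !digit_rec IH ?(ltnW md) ?H //.
by move=> k km; apply: H; apply: leqW.
Qed.

Lemma midx_lex p q : p < q < Nprod n ->
  exists2 k : 'I_d, (forall j : 'I_d, j < k -> midx n p j = midx n q j)
                  & midx n p k < midx n q k.
Proof.
case/andP=> pq qN; have pN := ltn_trans pq qN.
have [k dk mink] : exists2 k : 'I_d, midx n p k != midx n q k &
    forall j : 'I_d, j < k -> midx n p j = midx n q j.
  case: (pickP [pred k | midx n p k != midx n q k]) => [k0 dk0|same].
    case: (arg_minnP (fun k : 'I_d => val k) dk0) => k dk mink.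
    exists k => // j jk; apply/eqP; apply: contraTT jk => dj.
    by rewrite -leqNgt; apply: mink.
  have := @agree p q d (leqnn d) pN qN
    (fun k _ => eqP (negbFE (same k))).
  rewrite /T big_pred0 ?divn1; last by move=> j; rewrite leqNgt ltn_ord.
  by move=> E; rewrite E ltnn in pq.
exists k => //; rewrite ltn_neqAle dk /=.
have := leq_div2r (T k.+1) (ltnW pq).
rewrite !digit_rec (agree (ltnW (ltn_ord k)) pN qN mink) leq_add2l.
by rewrite /midx.
Qed.

Lemma midx_onto (i : 'I_d -> nat) : (forall k, 1 <= i k <= n k) ->
  exists2 p, p < Nprod n & forall k, midx n p k = i k.
Proof.
move=> iB.
have dig (j : 'I_d -> nat) k : 1 <= j k <= n k -> (j k).-1 < n k.
  by case/andP; case: (j k).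
pose f (p : 'I_(Nprod n)) : {dffun forall k : 'I_d, 'I_(n k)} :=
  [ffun k => Ordinal (dig (midx n p) k (midx_bounds p k))].
have finj : injective f.
  have sep (p q : 'I_(Nprod n)) : p < q -> f p <> f q.
    move=> pq E.
    have [|k _] := @midx_lex p q; first by rewrite pq ltn_ord.
    have /(congr1 val) := congr1 (fun g : {dffun _} => g k) E.
    rewrite !ffunE /=.
    by rewrite /midx /= => ->; rewrite ltnn.
  move=> p q E; apply: val_inj; case: (ltngtP p q) => // /sep; first by [].
  by rewrite E.
have cardE : #|{dffun forall k : 'I_d, 'I_(n k)}| <= #|'I_(Nprod n)|.
  rewrite card_dep_ffun card_ord /Nprod -big_enum /= foldrE big_map.
  by under eq_bigr do rewrite card_ord.
have [g _ fg] := inj_card_bij finj cardE.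
pose t : {dffun forall k : 'I_d, 'I_(n k)} := [ffun k => Ordinal (dig i k (iB k))].
exists (g t) => // k.
have /(congr1 val) := congr1 (fun h : {dffun _} => h k) (fg t).
rewrite !ffunE /=.
by rewrite /midx /= => ->; rewrite prednK //; case/andP: (iB k).
Qed.

End MidxTheory.

(* Main.v *)
Require Import Defs.
From mathcomp Require Import all_boot all_order all_algebra complex.
From mathcomp Require Import boolp classical_sets reals numfun.

Set Implicit Arguments.
Unset Strict Implicit.
Unset Printing Implicit Defensive.

Import GRing.Theory.
Local Open Scope ring_scope.
Local Open Scope complex_scope.

(** For S a set of block positions, the matrix R keeping the block rows in S
    satisfies R *m R^T = 1 and R^T *m R = P, the diagonal projection onto the
    blocks in S ([Rmx_mul_tr], [tr_Rmx_mul]).  Since a grid point of the cube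
    lies in exactly one of the sets Omega i, the matrices R_i attached to them
    have in addition R_i *m R_j^T = 0 for i != j, and P_1 + ... + P_nu = 1
    ([Rmx_orthogonal], [sum_Rmx]): up to a permutation of the blocks, their
    stack is an orthogonal matrix that puts D in block diagonal form with
    diagonal blocks B_i = R_i *m A *m R_i^T, because P_i *m A *m P_i =
    R_i^T *m B_i *m R_i.  So D is inverted block by block: its inverse is
    the sum of the R_i^T *m B_i^-1 *m R_i, which are the matrices RIE, and
    multiplying that sum by P_i on either side selects the i-th term.  This last
    part uses the displayed relations only, so it is done for an arbitrary
    orthogonal family R_i over a ring ([mul_sum_conj],
    [diag_mul_sum_conj], [sum_conj_mul_diag]). *)

Section OrthogonalFamily.
Variables (F : pzRingType) (m nu : nat) (k : 'I_nu -> nat).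
Variable R : forall i, 'M[F]_(k i, m).
Hypothesis R_unitary : forall i, R i *m (R i)^T = 1%:M.
Hypothesis R_orthogonal : forall i j, i != j -> R i *m (R j)^T = 0.

(** R_i kills all the summands but the i-th, which has its range in that of the
    projection R_i^T *m R_i. *)
Lemma diag_mul_sum_conj (C : forall i, 'M[F]_(k i)) i :
  (R i)^T *m R i *m (\sum_j (R j)^T *m C j *m R j) = (R i)^T *m C i *m R i.
Proof.
rewrite mulmx_sumr (bigD1 i) //= big1 ?addr0 => [|j ji].
  by rewrite -!mulmxA (mulmxA (R i)) R_unitary mul1mx.
by rewrite -!mulmxA (mulmxA (R i)) R_orthogonal 1?eq_sym // mul0mx mulmx0.
Qed.

Lemma sum_conj_mul_diag (C : forall i, 'M[F]_(k i)) i :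
  (\sum_j (R j)^T *m C j *m R j) *m ((R i)^T *m R i) = (R i)^T *m C i *m R i.
Proof.
rewrite mulmx_suml (bigD1 i) //= big1 ?addr0 => [|j ji].
  by rewrite -!mulmxA (mulmxA (R i)) R_unitary mul1mx.
by rewrite -!mulmxA (mulmxA (R j)) R_orthogonal // mul0mx !mulmx0.
Qed.

(** In the basis given by the R_i, the sums are block diagonal matrices, hence
    they multiply block by block. *)
Lemma mul_sum_conj (B C : forall i, 'M[F]_(k i)) :
  (\sum_i (R i)^T *m B i *m R i) *m (\sum_i (R i)^T *m C i *m R i)
    = \sum_i (R i)^T *m (B i *m C i) *m R i.
Proof.
set S := \sum_i (R i)^T *m C i *m R i.
have RS i : R i *m S = C i *m R i.
  (* Insert R_i *m R_i^T = 1 to let the projection P_i act on the sum. *)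
  rewrite -[LHS]mul1mx -(R_unitary i) -mulmxA (mulmxA (R i)^T).
  by rewrite diag_mul_sum_conj -!mulmxA mulmxA R_unitary mul1mx.
by rewrite mulmx_suml; apply: eq_bigr => i _; rewrite -!mulmxA RS.
Qed.

End OrthogonalFamily.

Section Restriction.
Variables (R : realType) (d s : nat) (n : 'I_d -> nat).
Implicit Types Omega : set 'rV[R]_d.

Lemma in_Iset Omega p : (p \in Iset n Omega) = (gridpt R n p \in Omega).
Proof. by rewrite inE. Qed.

(** The definition of the restriction matrix as a 0/1 block matrix, which turns
    its products into sums of Kronecker symbols. *)
Lemma Rmx_mxblock Omega :
  Rmx s n Omega = \mxblock_(r < Ncard n Omega, q < Nprod n)
    ((enum_val (r : 'I_#|Iset n Omega|) == q)%:R%:M : 'M[R[i]]_s).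
Proof.
rewrite mxblockEv /Rmx /Dmx; apply: eq_mxcol => r.
rewrite /mxdiag mxblockEv mxcolK; apply: eq_mxrow => q.
case: eqVneq => [_|]; last by rewrite raddf0.
have := enum_valP (r : 'I_#|Iset n Omega|).
by rewrite in_Iset conform_mx_id /chiI indicE => ->.
Qed.

Lemma Rmx_mul_tr_mxblock Omega Omega' :
  Rmx s n Omega *m (Rmx s n Omega')^T
    = \mxblock_(r < Ncard n Omega, t < Ncard n Omega')
        ((enum_val (r : 'I_#|Iset n Omega|)
            == enum_val (t : 'I_#|Iset n Omega'|))%:R%:M : 'M[R[i]]_s).
Proof.
rewrite !Rmx_mxblock tr_mxblock mul_mxblock; apply: eq_mxblock => r t.
under eq_bigr do rewrite tr_scalar_mx -scalar_mxM -natrM mulnb.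
rewrite (bigD1 (enum_val r)) //= eqxx /= big1 ?addr0 => [|q /negbTE qr].
  by rewrite eq_sym.
by rewrite eq_sym qr raddf0.
Qed.

Lemma Rmx_mul_tr Omega : Rmx s n Omega *m (Rmx s n Omega)^T = 1%:M.
Proof.
rewrite Rmx_mul_tr_mxblock -mxdiagZ; apply: eq_mxblock => r t.
by rewrite (inj_eq enum_val_inj) conform_mx_id; case: eqP; rewrite ?raddf0.
Qed.

Lemma Rmx_orthogonal Omega Omega' : [disjoint Iset n Omega & Iset n Omega'] ->
  Rmx s n Omega *m (Rmx s n Omega')^T = 0.
Proof.
move=> dis; rewrite Rmx_mul_tr_mxblock -[RHS]mxblock0.
apply: eq_mxblock => r t; case: eqP => [rt|]; last by rewrite raddf0.
have := enum_valP (t : 'I_#|Iset n Omega'|).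
by rewrite -rt (disjointFr dis) // enum_valP.
Qed.

Lemma tr_Rmx_mul Omega : (Rmx s n Omega)^T *m Rmx s n Omega
  = Dmx n (chiI s Omega).
Proof.
rewrite Rmx_mxblock tr_mxblock mul_mxblock; apply: eq_mxblock => p q.
under eq_bigr do rewrite tr_scalar_mx -scalar_mxM -natrM mulnb.
(* Sum over the kept positions themselves instead of their ranks. *)
rewrite -(big_enum_val (fun x => ((x == p) && (x == q))%:R%:M)).
rewrite conform_mx_id /chiI indicE -in_Iset.
case: (eqVneq p q) => [<-|/negbTE pq].
  have [pO|pO] := boolP (p \in _).
    rewrite (bigD1 p) //= eqxx big1 ?addr0 // => x /andP[_ /negbTE ->].
    by rewrite raddf0.
  rewrite big1 ?raddf0 // => x xO; case: eqP => [xp|]; last by rewrite raddf0.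
  by rewrite -xp xO in pO.
by rewrite big1 // => x _; case: eqP => [->|]; rewrite ?pq raddf0.
Qed.

(** Zeroing is restriction followed by extension, as the projection factors
    through the restriction matrix. *)
Lemma Zop_restr Omega (A : 'M[R[i]]_(bdim (Nprod n) s)) :
  Zop Omega Omega A = (Rmx s n Omega)^T *m restr Omega A *m Rmx s n Omega.
Proof. by rewrite /Zop -tr_Rmx_mul /restr !mulmxA. Qed.

End Restriction.

Section Partition.
Variables (R : realType) (d s nu : nat) (n : 'I_d -> nat).
Hypothesis n_gt0 : forall k, (0 < n k)%N.
Variable Omega : 'I_nu -> set 'rV[R]_d.
Hypothesis Omega_part : cube_partition Omega.

Lemma gridpt_unit_cube p : unit_cube (gridpt R n p).
Proof.
move=> k; rewrite mxE; have /andP[_ le_n] := midx_bounds n_gt0 p k.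
rewrite Num.Theory.divr_ge0 ?Num.Theory.ler0n //=.
by rewrite Num.Theory.ler_pdivrMr ?Num.Theory.ltr0n // mul1r Num.Theory.ler_nat.
Qed.

Lemma disjoint_Iset i j : i != j ->
  [disjoint Iset n (Omega i) & Iset n (Omega j)].
Proof.
move=> ij; apply/pred0P => p /=; rewrite !in_Iset.
apply/negP => /andP[/set_mem Op_i /set_mem Op_j]; move/eqP: ij; apply.
by apply: (Omega_part.1 i j) => //; exists (gridpt R n p).
Qed.

(** Partition of unity: this is where the sets must cover all grid points. *)
Lemma sum_Rmx :
  \sum_i (Rmx s n (Omega i))^T *m Rmx s n (Omega i) = 1%:M.
Proof.
rewrite (eq_bigr _ (fun i _ => tr_Rmx_mul s n (Omega i))) /Dmx.
rewrite -mxdiag_sum -mxdiagZ; apply: eq_mxdiag => p.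
have := gridpt_unit_cube p; rewrite -Omega_part.2 => -[i _ Op_i].
have p_i : p \in Iset n (Omega i) by rewrite in_Iset; exact: mem_set.
rewrite (bigD1 i) //= big1 ?addr0 => [|j ji].
  by rewrite /chiI indicE mem_set.
rewrite /chiI indicE; have := disjointFl (disjoint_Iset ji) p_i.
by rewrite in_Iset => ->; rewrite raddf0.
Qed.

End Partition.

Theorem theorem6p1 (R : realType) (d s nu : nat)
    (d_gt0 : (0 < d)%N) (s_gt0 : (0 < s)%N) (nu_gt0 : (0 < nu)%N)
    (n : 'I_d -> nat) (n_gt0 : forall k : 'I_d, (0 < n k)%N)
    (Omega : 'I_nu -> set 'rV[R]_d) (Omega_part : cube_partition Omega)
    (A : 'M[R[i]]_(bdim (Nprod n) s))
    (A_unit : forall i : 'I_nu, restr (Omega i) A \in unitmx) :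
  let D := blockdiag Omega A in
  [/\ D \in unitmx,
      invmx D = \sum_(i < nu) RIE (Omega i) A
    & forall i : 'I_nu,
        [/\ RIE (Omega i) A = Dmx n (chiI s (Omega i)) *m invmx D,
            Dmx n (chiI s (Omega i)) *m invmx D
              = invmx D *m Dmx n (chiI s (Omega i)),
            invmx D *m Dmx n (chiI s (Omega i))
              = Dmx n (chiI s (Omega i)) *m invmx D
                  *m Dmx n (chiI s (Omega i))
          & Dmx n (chiI s (Omega i)) *m invmx D
                  *m Dmx n (chiI s (Omega i))
              = Zop (Omega i) (Omega i) (invmx D)]].
Proof.
pose r i := Rmx s n (Omega i).
have rU i : r i *m (r i)^T = 1%:M by apply: Rmx_mul_tr.
have rO i j : i != j -> r i *m (r j)^T = 0.
  by move=> ij; apply/Rmx_orthogonal/disjoint_Iset.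
have rP i : Dmx n (chiI s (Omega i)) = (r i)^T *m r i by rewrite tr_Rmx_mul.
move=> D.
pose E := \sum_(i < nu) RIE (Omega i) A.
have DE : D *m E = 1%:M.
  rewrite /D /blockdiag (eq_bigr _ (fun i _ => Zop_restr (Omega i) A)).
  rewrite /E /RIE /expand (mul_sum_conj rU rO) -(sum_Rmx s n_gt0 Omega_part).
  by apply: eq_bigr => i _; rewrite mulmxV // mulmx1.
have [D_unit _] := mulmx1_unit DE.
have DV : invmx D = E by rewrite -[E](mulKmx D_unit) DE mulmx1.
have PE i : Dmx n (chiI s (Omega i)) *m E = RIE (Omega i) A.
  by rewrite rP (diag_mul_sum_conj rU rO).
have EP i : E *m Dmx n (chiI s (Omega i)) = RIE (Omega i) A.
  by rewrite rP (sum_conj_mul_diag rU rO).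
split=> // i; rewrite /Zop DV PE EP; split=> //.
by rewrite rP /RIE /expand -/(r i) -!mulmxA (mulmxA (r i)) rU mul1mx.
Qed.
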